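(* Let $a,b$ be given nonnegative integers and $\alpha=\frac{1+\sqrt5}{2}$. Then, as $n\to\infty$, $$G^+_{1,0,a,b}(n)=2^{-a}\,5^{-(a+b+1)/2}\,n^{2a+b}\,\alpha^{n+2-a-b}+O(n^{2a+b-1}\alpha^n).$$
   Context: For $n\ge0$ let $\mathcal{A}_{1,n}=\{(1,j):1\le j\le n\}$, and let $\mathcal{B}^+_{1,n}$ be the set of subsets $I\subseteq\mathcal{A}_{1,n}$ such that $(1,j)\in I$ with $1\le j\le n-1$ implies $(1,j+1)\notin I$ (i.e. subsets of $\{1,\dots,n\}$ with no two consecutive elements). For such $I$, $|I|$ is its cardinality and $\sigma_0(I)=\sum_{(1,j)\in I}j$. Define $G^+_{1,0,a,b}(n)=\sum_{I\in\mathcal{B}^+_{1,n}}\sigma_0(I)^a|I|^b$ (with $0^0=1$). *)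

(* Defs.v *)
From mathcomp Require Import all_boot all_order all_algebra.
From mathcomp Require Import all_classical all_reals all_analysis.

Set Implicit Arguments.
Unset Strict Implicit.
Unset Printing Implicit Defensive.

(* The pair (1, j), 1 <= j <= n, is encoded by the ordinal i : 'I_n with
   j = i.+1; a subset of A_{1,n} is thus an I : {set 'I_n}. *)
Definition label (n : nat) (i : 'I_n) : nat := i.+1.

(* The bound j <= n - 1 is implied by k being an index with label j + 1. *)
Definition Bplus (n : nat) : {set {set 'I_n}} :=
  [set I : {set 'I_n} | [forall i : 'I_n, forall k : 'I_n,
     (i \in I) ==> (label k == (label i).+1) ==> (k \notin I)]].

Definition sigma0 (n : nat) (I : {set 'I_n}) : nat := (\sum_(i in I) label i)%N.

(* In nat, 0 ^ 0 = 1. *)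
Definition Gplus (a b n : nat) : nat :=
  (\sum_(I in Bplus n) sigma0 I ^ a * #|I| ^ b)%N.

Definition golden (R : realType) : R := ((1 + Num.sqrt 5) / 2)%R.

(* Main.v *)
(* Divide by alpha ^ n.  Splitting the sets on whether they contain n + 2 and expanding
   (sigma + n + 2) ^ a (|I| + 1) ^ b shows that u_(a,b)(n) = G_(a,b)(n) / alpha ^ n satisfies
     u(n+2) = u(n+1) / alpha + u(n) / alpha^2 + (terms in u_(i,j)(n), i + j < a + b).
   Only (i,j) = (a-1,b) and (a,b-1) contribute to the leading order n^(2a+b-1) of the last
   part.  With q = alpha^-2 = 1 - alpha^-1 the differences of u satisfy
   d(n+1) = - q d(n) + g(n), and 0 < q < 1, so a forcing term K n^m + O(n^(m-1)) produces
   u(n) = K / ((1+q)(m+1)) n^(m+1) + O(n^m); the theorem follows by induction on a + b. *)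
Require Import Defs.
From mathcomp Require Import all_boot all_order all_algebra.
From mathcomp Require Import all_classical all_reals all_analysis.
From mathcomp Require Import ring lra zify.
Import Order.TTheory GRing.Theory Num.Theory.
Import numFieldNormedType.Exports.
Local Open Scope classical_set_scope.
Local Open Scope ring_scope.

(** * Recurrences for [Gplus] from removing the last index *)

(** [lift ord_max] keeps the value of an index, so labels and adjacency survive the passage from
    ['I_n] to ['I_n.+1]. *)
Definition widen_set (n : nat) (J : {set 'I_n}) : {set 'I_n.+1} :=
  [set lift ord_max x | x in J]%SET.

Lemma mem_widen_set (n : nat) (J : {set 'I_n}) (x : 'I_n) :
  (lift ord_max x \in widen_set n J) = (x \in J).
Proof. by rewrite mem_imset //; exact: lift_inj. Qed.

Lemma ord_max_widen_set (n : nat) (J : {set 'I_n}) :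
  (ord_max \in widen_set n J) = false.
Proof.
by apply/negP => /imsetP[x _ /eqP]; rewrite (negbTE (neq_lift _ _)).
Qed.

(** A set is determined by its trace [r] on the first [n] indices and by whether it contains the
    last one. [P] is arbitrary so that the split can be iterated. *)
Lemma big_set_ordS (n : nat) (P : pred {set 'I_n.+1})
    (F : {set 'I_n.+1} -> nat) :
  (\sum_(I | P I) F I =
   \sum_(J | P (widen_set n J)) F (widen_set n J) +
   \sum_(J | P (ord_max |: widen_set n J)%SET)
      F (ord_max |: widen_set n J)%SET)%N.
Proof.
pose r (I : {set 'I_n.+1}) : {set 'I_n} := [set x | lift ord_max x \in I]%SET.
have rL J : r (widen_set n J) = J.
  by apply/setP => x; rewrite inE mem_widen_set.
have rM J : r (ord_max |: widen_set n J)%SET = J.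
  by apply/setP => x; rewrite !inE mem_widen_set eq_sym (negbTE (neq_lift _ _)).
rewrite (bigID (fun I : {set 'I_n.+1} => ord_max \in I)) /= addnC; congr addn.
- rewrite (reindex_onto (@widen_set n) r) /=.
    apply: eq_bigl => J.
    by rewrite ord_max_widen_set rL eqxx !andbT.
  move=> I /andP[_ mI]; apply/setP => x; case: (unliftP ord_max x) => [y ->|->].
    by rewrite mem_widen_set inE.
  by rewrite ord_max_widen_set (negbTE mI).
- rewrite (reindex_onto (fun J => ord_max |: widen_set n J)%SET r) /=.
    apply: eq_bigl => J.
    by rewrite rM setU11 eqxx !andbT.
  move=> I /andP[_ mI]; apply/setP => x; rewrite in_setU1.
  case: (unliftP ord_max x) => [y ->|->].
    by rewrite mem_widen_set inE eq_sym (negbTE (neq_lift _ _)).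
  by rewrite eqxx mI.
Qed.

Lemma BplusP (n : nat) (I : {set 'I_n}) :
  reflect (forall i k : 'I_n, i \in I -> k = i.+1 :> nat -> k \notin I)
          (I \in Bplus n).
Proof.
rewrite inE; apply: (iffP forallP) => [H i k iI ki|H i].
  by have /forallP/(_ k) := H i; rewrite iI /label ki eqxx.
apply/forallP => k; apply/implyP => iI; apply/implyP => /eqP[ki].
exact: H ki.
Qed.

Lemma widen_set_Bplus (n : nat) (J : {set 'I_n}) :
  (widen_set n J \in Bplus n.+1) = (J \in Bplus n).
Proof.
apply/BplusP/BplusP => H i k.
  by have := H (lift ord_max i) (lift ord_max k); rewrite !mem_widen_set !lift_max.
case: (unliftP ord_max k) => [y ->|->]; last by rewrite ord_max_widen_set.
case: (unliftP ord_max i) => [x ->|->]; last by rewrite ord_max_widen_set.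
rewrite !mem_widen_set !lift_max; exact: H.
Qed.

(** The only new adjacent pair consists of the two last indices; [J] lives over ['I_n.+1] so that
    the lower of them exists. *)
Lemma ord_max_widen_set_Bplus (n : nat) (J : {set 'I_n.+1}) :
  ((ord_max |: widen_set n.+1 J)%SET \in Bplus n.+2) =
  (J \in Bplus n.+1) && (ord_max \notin J).
Proof.
apply/idP/andP => [/BplusP H|[/BplusP H mJ]].
  split.
    apply/BplusP => i k iJ ki.
    have := H (lift ord_max i) (lift ord_max k).
    rewrite !in_setU1 !mem_widen_set iJ orbT !lift_max => /(_ isT ki).
    by rewrite negb_or => /andP[].
  apply/negP => mJ.
  have := H (lift ord_max ord_max) ord_max.
  by rewrite !in_setU1 mem_widen_set mJ orbT eqxx lift_max => /(_ isT erefl).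
apply/BplusP => i k; rewrite !in_setU1.
case: (unliftP ord_max i) => [x ->|->]; last first.
  by move=> _ km; have := ltn_ord k; rewrite km /= ltnn.
rewrite eq_sym (negbTE (neq_lift _ _)) orFb mem_widen_set lift_max.
case: (unliftP ord_max k) => [y ->|-> /=]; last first.
  move=> xJ [mx]; case/negP: mJ; suff -> : ord_max = x by [].
  exact: val_inj.
rewrite eq_sym (negbTE (neq_lift _ _)) orFb mem_widen_set lift_max.
exact: H.
Qed.

Lemma card_widen_set (n : nat) (J : {set 'I_n}) : #|widen_set n J| = #|J|.
Proof. by rewrite card_imset //; exact: lift_inj. Qed.

Lemma sigma0_widen_set (n : nat) (J : {set 'I_n}) :
  sigma0 (widen_set n J) = sigma0 J.
Proof.
rewrite /sigma0 big_imset /=; last by move=> x y _ _; exact: lift_inj.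
by apply: eq_bigr => i _; rewrite /label lift_max.
Qed.

(** When the last index, of label [n.+2], is present, its neighbour is absent; a second split then
    leaves a set over ['I_n]. *)
Lemma Gplus_rec (a b n : nat) :
  Gplus a b n.+2 = (Gplus a b n.+1 +
    \sum_(I in Bplus n) (sigma0 I + n.+2) ^ a * #|I|.+1 ^ b)%N.
Proof.
rewrite {1}/Gplus big_set_ordS; congr addn.
  apply: eq_big => J; first exact: widen_set_Bplus.
  by rewrite sigma0_widen_set card_widen_set.
under eq_bigl do rewrite ord_max_widen_set_Bplus.
rewrite big_set_ordS [X in (_ + X)%N]big1 ?addn0; last first.
  by move=> J; rewrite setU11 andbF.
apply: eq_big => [J|J _].
  by rewrite ord_max_widen_set andbT widen_set_Bplus.
rewrite cardsU1 ord_max_widen_set !card_widen_set.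
rewrite /sigma0 big_setU1 ?ord_max_widen_set //=.
by rewrite -!/(sigma0 _) !sigma0_widen_set addnC.
Qed.

(** Initial values for the base case: with at most one index nothing is adjacent. *)
Lemma Gplus00_small (n : nat) : (n <= 1)%N -> Gplus 0 0 n = (2 ^ n)%N.
Proof.
move=> n1; rewrite /Gplus.
under eq_bigr do rewrite !expn0 muln1.
rewrite sum1_card (_ : Bplus n = [set: {set 'I_n}]%SET).
  by rewrite -powersetT card_powerset cardsT card_ord.
apply/setP => I; rewrite [RHS]inE; apply/BplusP => i k _ ki.
by have := ltn_ord k; rewrite ki ltnNge (leq_trans n1).
Qed.

Lemma Gplus_rec_binomial (a b n : nat) :
  Gplus a b n.+2 = (Gplus a b n.+1 +
    \sum_(i < a.+1) \sum_(j < b.+1)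
       'C(a, i) * 'C(b, j) * (n.+2 ^ (a - i) * Gplus i j n))%N.
Proof.
rewrite Gplus_rec; congr addn.
under eq_bigr => I _.
  rewrite addnC expnDn -(add1n #|I|) expnDn big_distrlr /=; over.
rewrite exchange_big /=; apply: eq_bigr => i _.
rewrite exchange_big /=; apply: eq_bigr => j _.
rewrite /Gplus !big_distrr /=; apply: eq_bigr => I _.
by rewrite exp1n mul1n mulnACA !mulnA.
Qed.

(** * Arithmetic of the golden ratio *)

Lemma sqr_golden (R : realType) : golden R ^+ 2 = golden R + 1.
Proof.
have : Num.sqrt 5 ^+ 2 = 5 :> R by rewrite sqr_sqrtr.
rewrite /golden; set s := Num.sqrt _ => s2.
rewrite (_ : _ ^+ 2 = (1 + 2 * s + s ^+ 2) / 4); last by field.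
by rewrite s2; field.
Qed.

Lemma golden_bounds (R : realType) : 3 / 2 < golden R < 2.
Proof.
have s2 : Num.sqrt 5 ^+ 2 = 5 :> R by rewrite sqr_sqrtr.
have s0 : 0 <= Num.sqrt 5 :> R by rewrite sqrtr_ge0.
rewrite /golden; apply/andP; split; nra.
Qed.

Lemma sqrt5E (R : realType) : Num.sqrt 5 = 2 * golden R - 1.
Proof. by rewrite /golden; field. Qed.

Lemma golden_gt0 (R : realType) : 0 < golden R.
Proof. by have := golden_bounds R; lra. Qed.

Lemma invr_sqr_golden (R : realType) : golden R ^- 2 = 1 - (golden R)^-1.
Proof.
have g0 := golden_gt0 R; have g2 := sqr_golden R.
apply: (@mulfI _ (golden R ^+ 2)); first by rewrite expf_neq0 ?gt_eqF.
rewrite divff ?expf_neq0 ?gt_eqF // mulrBr mulr1 expr2 mulfK ?gt_eqF //.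
by rewrite -expr2 g2 addrAC subrr add0r.
Qed.

(** The bound 1/2, from [golden R < 2], permits the explicit factors 2 in the later summation and
    contraction. *)
Lemma invr_sqr_golden_bounds (R : realType) : 0 < golden R ^- 2 < 1 / 2.
Proof.
have g0 := golden_gt0 R; have := golden_bounds R => /andP[gl gr].
rewrite invr_gt0 exprn_gt0 //= invr_sqr_golden.
have : 2^-1 < (golden R)^-1 by rewrite ltf_pV2 ?posrE.
lra.
Qed.

(** * Calculus of leading terms with error bounds *)

(* The error allowed for a leading term of degree m.  For m = 0 a mere O(1/n) would sum to
   log n at the next degree; exponential decay, which does hold there, is summable. *)
Definition poly_err (R : realType) (m n : nat) : R :=
  if m is k.+1 then n.+1%:R ^+ k else golden R ^- 2 ^+ n.

(* f n = c n ^ m + O(n ^ (m - 1)), with the above convention at m = 0. *)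
Definition asymp (R : realType) (m : nat) (c : R) (f : nat -> R) : Prop :=
  exists2 C, 0 <= C & forall n, `|f n - c * n%:R ^+ m| <= C * poly_err R m n.

Lemma err_ge0 (R : realType) (m n : nat) : 0 <= poly_err R m n.
Proof.
case: m => [|m] /=; last by rewrite exprn_ge0.
by rewrite exprn_ge0 // ltW //; have /andP[] := invr_sqr_golden_bounds R.
Qed.

(** For [m = 0] this combines [golden R ^- 2 < 1 / 2] with [n.+1 <= 2 ^ n]. *)
Lemma ler_mulS_err (R : realType) (m n : nat) :
  n.+1%:R * poly_err R m n <= poly_err R m.+1 n.
Proof.
case: m => [|m] /=; last by rewrite exprS.
have /andP[q0 q1] := invr_sqr_golden_bounds R.
have qn : golden R ^- 2 ^+ n <= 2^-1 ^+ n.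
  by rewrite lerXn2r ?nnegrE //; lra.
apply: le_trans (ler_wpM2l _ qn) _; first exact: ler0n.
by rewrite expr0 exprVn ler_pdivrMr ?exprn_gt0 // mul1r -natrX ler_nat ltn_expl.
Qed.

Lemma ler_err_S (R : realType) (m n : nat) : poly_err R m n <= poly_err R m.+1 n.
Proof.
apply: le_trans (ler_mulS_err R m n).
by rewrite ler_peMl ?err_ge0 // ler1n.
Qed.

Lemma ler_expn_err (R : realType) (m n : nat) : n%:R ^+ m <= poly_err R m.+1 n.
Proof. by rewrite /= lerXn2r ?nnegrE // ler_nat. Qed.

Lemma eq_asymp (R : realType) (m : nat) (c : R) (f g : nat -> R) :
  f =1 g -> asymp R m c f -> asymp R m c g.
Proof. by move=> fg [C C0 H]; exists C => // n; rewrite -fg. Qed.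

Lemma asympD (R : realType) (m : nat) (c d : R) (f g : nat -> R) :
  asymp R m c f -> asymp R m d g -> asymp R m (c + d) (fun n => f n + g n).
Proof.
move=> [C C0 H] [D D0 K]; exists (C + D); first exact: addr_ge0.
move=> n; rewrite !mulrDl opprD addrACA.
by apply: le_trans (ler_normD _ _) _; apply: lerD.
Qed.

Lemma asympZ (R : realType) (m : nat) (k c : R) (f : nat -> R) :
  asymp R m c f -> asymp R m (k * c) (fun n => k * f n).
Proof.
move=> [C C0 H]; exists (`|k| * C); first exact: mulr_ge0.
by move=> n; rewrite -!mulrA -mulrBr normrM ler_wpM2l.
Qed.

Lemma asympMn (R : realType) (m k : nat) (c : R) (f : nat -> R) :
  asymp R m c f -> asymp R m.+1 c (fun n => (n + k)%:R * f n).
Proof.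
(* The first summand comes from [n + k <= k.+1 * n.+1], applied to the error of [f]; the second pays
   for the shift by [k] in front of the leading term. *)
move=> [C C0 H]; exists (k.+1%:R * C + k%:R * `|c|).
  by rewrite addr_ge0 ?mulr_ge0.
move=> n.
have -> : (n + k)%:R * f n - c * n%:R ^+ m.+1 =
    (n + k)%:R * (f n - c * n%:R ^+ m) + k%:R * (c * n%:R ^+ m).
  by rewrite natrD exprS; ring.
apply: le_trans (ler_normD _ _) _; rewrite !normrM normrX !normr_nat mulrDl.
apply: lerD; last first.
  by rewrite -mulrA !ler_wpM2l //; exact: ler_expn_err.
apply: le_trans (ler_wpM2l _ (H n)) _ => //.
apply: (@le_trans _ _ ((k.+1 * n.+1)%:R * (C * poly_err R m n))).
  by rewrite ler_wpM2r ?mulr_ge0 ?err_ge0 // ler_nat; nia.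
rewrite natrM -mulrA [_%:R * (C * _)]mulrCA !mulrA.
by rewrite -[_ * _ * poly_err _ _ _]mulrA ler_wpM2l ?mulr_ge0 //; exact: ler_mulS_err.
Qed.

Lemma asympMXn (R : realType) (j m k : nat) (c : R) (f : nat -> R) :
  asymp R m c f -> asymp R (j + m) c (fun n => (n + k)%:R ^+ j * f n).
Proof.
move=> H; elim: j => [|j IH]; first by apply: eq_asymp H => n; rewrite mul1r.
by apply: eq_asymp (asympMn R _ k _ _ IH) => n; rewrite exprS mulrA.
Qed.

(** The leading term itself fits into the error of degree [m.+1], and errors grow with the
    degree. *)
Lemma asymp_lt (R : realType) (m m' : nat) (c : R) (f : nat -> R) :
  (m < m')%N -> asymp R m c f -> asymp R m' 0 f.
Proof.
move=> lt H.
have : asymp R m.+1 0 f.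
  case: H => C C0 H; exists (C + `|c|); first exact: addr_ge0.
  move=> n; rewrite mul0r subr0 -[f n](subrK (c * n%:R ^+ m)).
  apply: le_trans (ler_normD _ _) _; rewrite mulrDl lerD //.
    by apply: le_trans (H n) _; rewrite ler_wpM2l // ler_err_S.
  rewrite normrM normrX normr_nat ler_wpM2l //; exact: ler_expn_err.
move: lt; elim: m' => // m' IH; rewrite ltnS leq_eqVlt => /predU1P[-> //|lt].
move=> /(IH lt)[C C0 K]; exists C => // n; move: (K n); rewrite !mul0r => Kn.
by apply: le_trans Kn _; rewrite ler_wpM2l // ler_err_S.
Qed.

Lemma asymp_sum0 (R : realType) (m k : nat) (F : nat -> nat -> R) :
  (forall i, (i < k)%N -> asymp R m 0 (F i)) ->
  asymp R m 0 (fun n => \sum_(i < k) F i n).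
Proof.
elim: k => [|k IH] H.
  by exists 0 => // n; rewrite big_ord0 !mul0r subr0 normr0.
have := asympD _ _ _ _ _ _ (IH (fun i ik => H i (ltnW ik))) (H k (ltnSn k)).
by rewrite addr0; apply: eq_asymp => n; rewrite big_ord_recr.
Qed.

Lemma asympXn (R : realType) (m k : nat) :
  asymp R m 1 (fun n => (n + k)%:R ^+ m).
Proof.
have H : asymp R 0 1 (fun=> 1).
  by exists 0 => // n; rewrite expr0 mul0r mulr1 subrr normr0.
rewrite -{1}[m]addn0; apply: eq_asymp (asympMXn _ _ _ k _ _ H) => n.
by rewrite mulr1.
Qed.

(** With [x = n + k], induct through [(x+1)^(m+2) - x^(m+2) = x ((x+1)^(m+1) - x^(m+1)) +
    (x+1)^(m+1)]. *)
Lemma asymp_diffXn (R : realType) (m k : nat) :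
  asymp R m m.+1%:R (fun n => (n + k.+1)%:R ^+ m.+1 - (n + k)%:R ^+ m.+1).
Proof.
elim: m => [|m IH].
  by apply: eq_asymp (asympXn R 0 0) => n; rewrite addnS -natr1; ring.
have := asympD _ _ _ _ _ _ (asympMn _ _ k _ _ IH) (asympXn R m.+1 k.+1).
rewrite natr1; apply: eq_asymp => n.
by rewrite addnS -natr1 !exprS; ring.
Qed.

(** * Summing increments and inverting linear recurrences *)

(** Discrete integration: for [m = 0] the increments form a convergent geometric series; otherwise
    [n] increments of order [n ^ m.-1] add up to order [n ^ m]. *)
Lemma ler_sum_err (R : realType) (m : nat) (C : R) (w : nat -> R) :
  0 <= C -> (forall n, `|w n.+1 - w n| <= C * poly_err R m n) ->
  exists2 D, 0 <= D & forall n, `|w n| <= D * n.+1%:R ^+ m.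
Proof.
move=> C0 H.
have wS n : `|w n.+1| <= `|w n| + C * poly_err R m n.
  rewrite -[w n.+1](subrK (w n)) addrC.
  by apply: le_trans (ler_normD _ _) _; rewrite lerD2l.
have w0 := normr_ge0 (w 0%N).
case: m => [|m] in H wS *.
  have /andP[q0 q1] := invr_sqr_golden_bounds R.
  rewrite /= in wS; set q := golden R ^- 2 in q0 q1 wS.
  have qX n : 0 <= C * q ^+ n by rewrite mulr_ge0 // exprn_ge0 // ltW.
  (* The factor 2 works because q < 1/2 gives 1 <= 2 * (1 - q). *)
  exists (`|w 0%N| + 2 * C) => [|n]; first lra.
  rewrite expr0 mulr1.
  (* Subtracting [C * q ^+ n] strengthens the claim enough for the induction to close. *)
  suff : `|w n| <= `|w 0%N| + 2 * (C - C * q ^+ n) by have := qX n; lra.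
  elim: n => [|n IH]; first by rewrite expr0; lra.
  apply: le_trans (wS n) _; rewrite exprS mulrCA.
  by have := qX n; nra.
exists (`|w 0%N| + C); first exact: addr_ge0.
move=> n; apply: (@le_trans _ _ ((`|w 0%N| + C * n%:R) * n.+1%:R ^+ m)).
  elim: n => [|n IH]; first by rewrite mulr0 addr0 expr1n mulr1.
  apply: le_trans (wS n) _; apply: le_trans (lerD IH (lexx _)) _.
  rewrite /= -mulrDl -addrA -{2}[C]mulr1 -mulrDr natr1.
  by rewrite ler_wpM2l ?addr_ge0 ?mulr_ge0 // lerXn2r ?nnegrE // ler_nat.
rewrite exprS mulrA ler_wpM2r ?exprn_ge0 // mulrDl lerD //.
  by rewrite ler_peMr // ler1n.
by rewrite ler_wpM2l // ler_nat.
Qed.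

(** With [q = golden R ^- 2 < 1/2], the constant [D = |e 0| + 2 C] satisfies [C + q D <= D]. *)
Lemma ler_linear_rec (R : realType) (m : nat) (C : R) (e : nat -> R) :
  0 <= C -> (forall n, `|e n.+1 + golden R ^- 2 * e n| <= C * n.+1%:R ^+ m) ->
  exists2 D, 0 <= D & forall n, `|e n| <= D * n.+1%:R ^+ m.
Proof.
move=> C0 H; have /andP[q0 q1] := invr_sqr_golden_bounds R.
have e0 := normr_ge0 (e 0%N).
exists (`|e 0%N| + 2 * C) => [|n]; first lra.
elim: n => [|n IH]; first by rewrite expr1n; lra.
have X : n.+1%:R ^+ m <= n.+2%:R ^+ m :> R by rewrite lerXn2r ?nnegrE // ler_nat.
have X0 : 0 <= n.+1%:R ^+ m :> R by rewrite exprn_ge0.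
apply: (@le_trans _ _ ((`|e 0%N| + 2 * C) * n.+1%:R ^+ m)); last first.
  by rewrite ler_wpM2l //; lra.
rewrite -[e n.+1](addrK (golden R ^- 2 * e n)).
apply: le_trans (ler_normB _ _) _; rewrite normrM (gtr0_norm q0).
apply: le_trans (lerD (H n) (ler_wpM2l (ltW q0) IH)) _.
have : 0 <= (`|e 0%N| + 2 * C) * n.+1%:R ^+ m by rewrite mulr_ge0 //; lra.
have : 0 <= `|e 0%N| * n.+1%:R ^+ m by rewrite mulr_ge0 //.
nra.
Qed.

(* e(n+2) - e(n+1) / alpha - q e(n) is the increment of e(n+1) + q e(n): sum it, then invert
   the contraction. *)
Lemma asymp_fib_rec (R : realType) (m : nat) (K : R) (u g : nat -> R) :
  (forall n, u n.+2 = (golden R)^-1 * u n.+1 + golden R ^- 2 * u n + g n) ->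
  asymp R m K g -> asymp R m.+1 (K / ((1 + golden R ^- 2) * m.+1%:R)) u.
Proof.
move=> urec gK; set c := K / _.
have /andP[q0 q1] := invr_sqr_golden_bounds R.
have pq := invr_sqr_golden R.
set q := golden R ^- 2 in q0 q1 pq urec c *.
have pE : (golden R)^-1 = 1 - q by rewrite pq; ring.
pose e n := u n - c * n%:R ^+ m.+1.
(* [h] is the forcing term left for [e]. Since [1 = (1 - q) + q], the subtracted power enters only
   through first differences, and [c] is chosen so that their leading terms cancel [K]. *)
pose h n := g n + (- c) * (((n + 2)%:R ^+ m.+1 - (n + 1)%:R ^+ m.+1) +
    q * ((n + 1)%:R ^+ m.+1 - (n + 0)%:R ^+ m.+1)).
have hK : asymp R m 0 h.
  have := asympD _ _ _ _ _ _ gK (asympZ _ _ (- c) _ _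
    (asympD _ _ _ _ _ _ (asymp_diffXn R m 1)
      (asympZ _ _ q _ _ (asymp_diffXn R m 0)))).
  have -> : m.+1%:R + q * m.+1%:R = (1 + q) * m.+1%:R by ring.
  rewrite mulNr divfK ?subrr //.
  by rewrite mulf_neq0 ?pnatr_eq0 // gt_eqF // addr_gt0.
have hE n : h n = (e n.+2 + q * e n.+1) - (e n.+1 + q * e n).
  by rewrite /h /e urec pE addn2 addn1 addn0; ring.
case: hK => C C0 hC.
have [n|D D0 wD] := @ler_sum_err R m C (fun n => e n.+1 + q * e n) C0.
  by have := hC n; rewrite mul0r subr0 hE.
have [E E0 eE] := @ler_linear_rec R m D e D0 wD.
by exists E.
Qed.

(** * Asymptotics of the normalised sums, by induction on [a + b] *)

Definition normG (R : realType) (a b n : nat) : R :=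
  (Gplus a b n)%:R / golden R ^+ n.

Definition normG_term (R : realType) (a b i j n : nat) : R :=
  ('C(a, i) * 'C(b, j))%:R * ((n + 2)%:R ^+ (a - i) * normG R i j n).

Lemma normG_rec (R : realType) (a b n : nat) :
  normG R a b n.+2 = (golden R)^-1 * normG R a b n.+1 +
    golden R ^- 2 * \sum_(i < a.+1) \sum_(j < b.+1) normG_term R a b i j n.
Proof.
have g0 : golden R != 0 by rewrite gt_eqF ?golden_gt0.
rewrite /normG Gplus_rec_binomial natrD mulrDl; congr (_ + _).
  by rewrite [golden R ^+ n.+2]exprS invfM mulrCA.
rewrite -addn2 exprD invfM mulrA [LHS]mulrC; congr (_ * _).
rewrite natr_sum mulr_suml; apply: eq_bigr => i _.
rewrite natr_sum mulr_suml; apply: eq_bigr => j _.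
by rewrite /normG_term /normG !natrM natrX !mulrA.
Qed.

(** Grouped so that lowering [b] multiplies it by [Num.sqrt 5 * golden R], and lowering [a] by twice
    that. *)
Definition lead_normG (R : realType) (a b : nat) : R :=
  golden R ^+ 2 / Num.sqrt 5 * 2 ^- a * (Num.sqrt 5 * golden R) ^- (a + b).

(** Divided by [golden R ^+ 2], this evaluates the factor [1 + golden R ^- 2] produced by
    [asymp_fib_rec]. *)
Lemma sqrt5_mul_golden (R : realType) :
  Num.sqrt 5 * golden R = golden R ^+ 2 + 1.
Proof. by rewrite sqrt5E; have := sqr_golden R; nra. Qed.

(** The quantity [w] is invariant, so the distance to the fixed point of [v -> golden R - q v] is
    multiplied by [- q] at each step. *)
Lemma asymp_normG00 (R : realType) : asymp R 0 (lead_normG R 0 0) (normG R 0 0).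
Proof.
have g0 := golden_gt0 R.
have g2 := sqr_golden R.
have s0 : Num.sqrt 5 != 0 :> R by rewrite sqrt5E; have := golden_bounds R; lra.
have /andP[q0 q1] := invr_sqr_golden_bounds R.
have pq := invr_sqr_golden R.
have sg := sqrt5_mul_golden R.
have lE : (1 + golden R ^- 2) * lead_normG R 0 0 = golden R.
  rewrite /lead_normG addn0 !expr0 !invr1 !mulr1.
  have -> : 1 + golden R ^- 2 = Num.sqrt 5 * golden R / golden R ^+ 2.
    by rewrite sg; field; rewrite gt_eqF.
  by field; rewrite s0 gt_eqF.
set q := golden R ^- 2 in q0 q1 pq lE *.
have gE : golden R = 1 + (golden R)^-1.
  by apply: (@mulfI _ (golden R)); rewrite ?mulrDr ?mulr1 ?mulfV ?gt_eqF // -expr2.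
have rec n : normG R 0 0 n.+2 =
    (golden R)^-1 * normG R 0 0 n.+1 + q * normG R 0 0 n.
  by rewrite normG_rec !big_ord1 /normG_term bin0 muln1 expr0 !mul1r.
have w n : normG R 0 0 n.+1 + q * normG R 0 0 n = golden R.
  elim: n => [|n IH].
    rewrite /normG !Gplus00_small // expr0 expr1 invr1 !mulr1.
    by rewrite [RHS]gE pq; ring.
  by rewrite rec -[RHS]IH pq; ring.
exists (`|normG R 0 0 0 - lead_normG R 0 0|) => // n; rewrite expr0 mulr1 /=.
elim: n => [|n IH]; first by rewrite mulr1.
have -> : normG R 0 0 n.+1 - lead_normG R 0 0 = - q * (normG R 0 0 n - lead_normG R 0 0).
  by have := w n; rewrite -[X in _ = X -> _]lE; lra.
by rewrite normrM normrN (gtr0_norm q0) -/q exprS mulrCA ler_wpM2l // ltW.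
Qed.

Lemma asymp_normG_term (R : realType) (a b i j : nat) :
  asymp R (2 * i + j) (lead_normG R i j) (normG R i j) ->
  asymp R (a - i + (2 * i + j)) (('C(a, i) * 'C(b, j))%:R * lead_normG R i j)
    (normG_term R a b i j).
Proof. by move=> H; apply/asympZ/asympMXn. Qed.

(** The term [(i, j)] has degree [a + i + j]; besides [(a, b)], only [(a-1, b)] and [(a, b-1)] reach
    [2 a + b - 1]. *)
Lemma asymp_normG_step (R : realType) (a b : nat) : (0 < a + b)%N ->
  (forall i j, (i <= a)%N -> (j <= b)%N -> (i + j < a + b)%N ->
    asymp R (2 * i + j) (lead_normG R i j) (normG R i j)) ->
  asymp R (2 * a + b) (lead_normG R a b) (normG R a b).
Proof.
move=> ab0 IH.
have lower i j m : (i <= a)%N -> (j <= b)%N -> (i + j < a + b)%N ->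
    (a - i + (2 * i + j) < m)%N -> asymp R m 0 (normG_term R a b i j).
  by move=> ia jb ij /asymp_lt; apply; apply/asymp_normG_term/IH.
(* For [a = 0] the sum is empty and the factor [a%:R] kills the meaningless [a.-1]; likewise for [b]
   in [S2]. *)
have S1 : asymp R (2 * a + b).-1 (a%:R * lead_normG R a.-1 b)
    (fun n => \sum_(i < a) \sum_(j < b.+1) normG_term R a b i j n).
  case: a => [|a] in ab0 IH lower *.
    by exists 0 => // n; rewrite big_ord0 !mul0r subr0 normr0.
  have H1 : asymp R (2 * a.+1 + b).-1 0
      (fun n => \sum_(i < a) \sum_(j < b.+1) normG_term R a.+1 b i j n).
    apply: (asymp_sum0 _ _ a (fun i n => \sum_(j < b.+1) normG_term R a.+1 b i j n)).
    move=> i ia; apply: (asymp_sum0 _ _ b.+1 (normG_term R a.+1 b i)) => j jb.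
    by apply: lower; lia.
  have H2 : asymp R (2 * a.+1 + b).-1 0
      (fun n => \sum_(j < b) normG_term R a.+1 b a j n).
    apply: (asymp_sum0 _ _ b (normG_term R a.+1 b a)) => j jb.
    by apply: lower; lia.
  have H3 : asymp R (2 * a.+1 + b).-1 (a.+1%:R * lead_normG R a b)
      (normG_term R a.+1 b a b).
    have := @asymp_normG_term R a.+1 b a b (IH a b _ _ _).
    rewrite binSn binn muln1 (_ : (_ - _ + _ = (2 * a.+1 + b).-1)%N); last by lia.
    by apply; lia.
  have := asympD _ _ _ _ _ _ H1 (asympD _ _ _ _ _ _ H2 H3).
  by rewrite !add0r; apply: eq_asymp => n; rewrite !big_ord_recr.
have S2 : asymp R (2 * a + b).-1 (b%:R * lead_normG R a b.-1)
    (fun n => \sum_(j < b) normG_term R a b a j n).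
  case: b => [|b] in ab0 IH lower S1 *.
    by exists 0 => // n; rewrite big_ord0 !mul0r subr0 normr0.
  have H2 : asymp R (2 * a + b.+1).-1 0
      (fun n => \sum_(j < b) normG_term R a b.+1 a j n).
    apply: (asymp_sum0 _ _ b (normG_term R a b.+1 a)) => j jb.
    by apply: lower; lia.
  have H3 : asymp R (2 * a + b.+1).-1 (b.+1%:R * lead_normG R a b)
      (normG_term R a b.+1 a b).
    have := @asymp_normG_term R a b.+1 a b (IH a b _ _ _).
    rewrite binSn binn mul1n (_ : (_ - _ + _ = (2 * a + b.+1).-1)%N); last by lia.
    by apply; lia.
  have := asympD _ _ _ _ _ _ H2 H3.
  by rewrite add0r; apply: eq_asymp => n; rewrite big_ord_recr.
(* The term [(a, b)] moves to the homogeneous part; the rest is the forcing term. *)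
have rec n : normG R a b n.+2 =
    (golden R)^-1 * normG R a b n.+1 + golden R ^- 2 * normG R a b n +
    golden R ^- 2 * (\sum_(i < a) \sum_(j < b.+1) normG_term R a b i j n +
                     \sum_(j < b) normG_term R a b a j n).
  rewrite normG_rec big_ord_recr /=.
  rewrite [\sum_(j < b.+1) normG_term R a b a j n]big_ord_recr /=.
  have -> : normG_term R a b a b n = normG R a b n.
    by rewrite /normG_term !binn subnn expr0 !mul1r.
  by ring.
have := asymp_fib_rec _ _ _ _ _ rec (asympZ _ _ _ _ _ (asympD _ _ _ _ _ _ S1 S2)).
rewrite prednK; last by lia.
set c := (X in asymp _ _ X); suff -> : c = lead_normG R a b by [].
have g0 := golden_gt0 R.
have s0 : Num.sqrt 5 != 0 :> R by rewrite sqrt5E; have := golden_bounds R; lra.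
have /andP[q0 q1] := invr_sqr_golden_bounds R.
have sg0 : Num.sqrt 5 * golden R != 0 by rewrite mulf_neq0 // gt_eqF.
have la : a%:R * lead_normG R a.-1 b =
    (2 * a)%:R * (Num.sqrt 5 * golden R) * lead_normG R a b.
  case: (a) => [|k]; first by rewrite muln0 !mul0r.
  rewrite /lead_normG /= addSn [2 ^+ k.+1]exprS [(_ * _) ^+ (k + b).+1]exprS natrM.
  have x0 := expf_neq0 (k + b) sg0; have y0 : 2 ^+ k != 0 :> R.
    by rewrite expf_neq0 // pnatr_eq0.
  set x := _ ^+ (k + b) in x0 *; set y := 2 ^+ k in y0 *.
  by field; rewrite x0 y0 s0 gt_eqF.
have lb : b%:R * lead_normG R a b.-1 = b%:R * (Num.sqrt 5 * golden R) * lead_normG R a b.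
  case: (b) => [|k]; first by rewrite !mul0r.
  rewrite /lead_normG /= addnS [(_ * _) ^+ (a + k).+1]exprS.
  have x0 := expf_neq0 (a + k) sg0; have y0 : 2 ^+ a != 0 :> R.
    by rewrite expf_neq0 // pnatr_eq0.
  set x := _ ^+ (a + k) in x0 *; set y := 2 ^+ a in y0 *.
  by field; rewrite x0 y0 s0 gt_eqF.
rewrite /c la lb -!mulrDl -natrD.
(* The forcing coefficient is now [(2 a + b)] times this same factor times [lead_normG R a b], so
   all but the last cancels. *)
have -> : 1 + golden R ^- 2 = golden R ^- 2 * (Num.sqrt 5 * golden R).
  by rewrite sqrt5_mul_golden; field; rewrite gt_eqF.
set x := lead_normG R a b; field.
by rewrite s0 gt_eqF // -natrM -natrD pnatr_eq0; lia.
Qed.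

Lemma asymp_normG (R : realType) (a b : nat) :
  asymp R (2 * a + b) (lead_normG R a b) (normG R a b).
Proof.
have [s] := ubnP (a + b)%N; elim: s a b => // s IH a b abs.
case: (posnP (a + b)) => [/eqP|ab0].
  by rewrite addn_eq0 => /andP[/eqP-> /eqP->]; exact: asymp_normG00.
by apply: asymp_normG_step => // i j _ _ ij; apply: IH; lia.
Qed.

(** * Translation to the exponents and Landau symbol of the statement *)

(** Multiplying by [n] reduces this to [(n + 1)^m <= (2 n)^m], whence the factor [2 ^+ m]. *)
Lemma ler_err_exprz (R : realType) (m n : nat) : (0 < n)%N ->
  poly_err R m n <= 2 ^+ m * n%:R ^ (m%:Z - 1).
Proof.
move=> n0; have n0' : 0 < n%:R :> R by rewrite ltr0n.
rewrite exprzDr ?unitfE ?gt_eqF // exprN1 mulrA ler_pdivlMr // mulrC.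
apply: (@le_trans _ _ (n.+1%:R * poly_err R m n)).
  by rewrite ler_wpM2r ?err_ge0 // ler_nat.
apply: le_trans (ler_mulS_err R m n) _; rewrite /= -exprMn lerXn2r ?nnegrE //.
by rewrite -natrM ler_nat; lia.
Qed.

Lemma leadE (R : realType) (a b n : nat) :
  2 ^ (- a%:Z) * 5 `^ (- (a + b + 1)%:R / 2) *
    golden R ^ (n%:Z + 2 - a%:Z - b%:Z) = lead_normG R a b * golden R ^+ n.
Proof.
have g0 : golden R != 0 by rewrite gt_eqF ?golden_gt0.
have gU : golden R \is a GRing.unit by rewrite unitfE.
have s0 : Num.sqrt 5 != 0 :> R by rewrite sqrt5E; have := golden_bounds R; lra.
rewrite mulrC [X in 5 `^ X]mulrC powRrM powR12_sqrt // powR_invn ?sqrtr_ge0 //.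
rewrite !exprzDr // -!exprnN !expr1z -exprnP.
rewrite /lead_normG; move: (golden R) => g.
by rewrite !exprD expr1 !exprMn !invfM; ring.
Qed.

(* Exponents that may be negative are integers, applied with the
   integer power [exprz]. *)
Theorem theorem6p1 (R : realType) (a b : nat) :
  (fun n : nat => (Gplus a b n)%:R : R) =
  (fun n : nat =>
     2 ^ (- a%:Z) * 5 `^ (- (a + b + 1)%:R / 2)
     * n%:R ^+ (2 * a + b) * golden R ^ (n%:Z + 2 - a%:Z - b%:Z))
  +O_\oo (fun n : nat =>
     n%:R ^ ((2 * a + b)%:Z - 1) * golden R ^+ n).
Proof.
apply/eqaddOP.
have [C C0 H] := asymp_normG R a b.
have gn n : 0 < golden R ^+ n by rewrite exprn_gt0 ?golden_gt0.
(* [C] may vanish; adding 1 makes the constant positive. *)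
apply/bigO_exP; exists (C * 2 ^+ (2 * a + b) + 1).
  by rewrite ltr_wpDl // mulr_ge0 // exprn_ge0.
near=> n.
(* When [2 * a + b = 0] the bound contains [n ^ -1], which is 0 at [n = 0]. *)
have n0 : (0 < n)%N by near: n; exists 1%N.
rewrite [X in `|X| <= _](_ : _ =
    (normG R a b n - lead_normG R a b * n%:R ^+ (2 * a + b)) * golden R ^+ n); last first.
  by rewrite mulrBl (mulrAC (lead_normG R a b)) -leadE divfK ?gt_eqF // mulrAC.
rewrite !normrM (gtr0_norm (gn n)) mulrA.
rewrite ler_pM2r //; apply: le_trans (H n) _.
have e := ler_err_exprz R (2 * a + b) n n0.
have zn : 0 <= n%:R ^ ((2 * a + b)%:Z - 1) :> R by rewrite exprz_ge0.
rewrite (ger0_norm zn); apply: le_trans (ler_wpM2l C0 e) _.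
by rewrite mulrA ler_wpM2r // lerDl.
Unshelve. all: by end_near.
Qed.
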